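(* Let $G$ be a finite undirected graph and let $F \subseteq E(G)$ be a set of edges. Then \[ \max \{|F \cap E(\mathcal{C})| \colon \mathcal{C} \text{ is a collection of edge-disjoint cycles of } G \} \;\ge\;\min \{|Y| \colon Y \subseteq E(G) \text{ hits all $F$-cycles in } G \}. \]
   Context: An $F$-cycle is a cycle of $G$ that contains at least one edge of $F$. For a collection $\mathcal{C}$ of cycles, $E(\mathcal{C})$ denotes the set of all edges contained in some cycle of $\mathcal{C}$. A set $Y$ of edges hits a cycle if the cycle contains an edge of $Y$. *)

(* Defs.v *)
From mathcomp Require Import all_boot.

Set Implicit Arguments.
Unset Strict Implicit.
Unset Printing Implicit Defensive.

(* Loops (one end) and parallel edges (same set of ends) are allowed; a simple
   graph is the case where [ends] is injective and every [#|ends e|] is 2. *)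
Record graph := Graph {
  vertex : finType;
  edge : finType;
  ends : edge -> {set vertex};
  ends_card : forall e, 0 < #|ends e| <= 2
}.

Section Cycles.

Variable G : graph.
Implicit Types (C F Y : {set edge G}) (CC : {set {set edge G}}).
Implicit Type p : seq (vertex G * edge G).

(* [p = [:: (v_0, e_0); ...; (v_k, e_k)]] stands for the closed walk
   v_0 e_0 v_1 ... v_k e_k v_0. [cycle] includes the closing step, so a loop
   gives a cycle of length 1 and two parallel edges a cycle of length 2. *)
Definition cyclic_walk p :=
  [&& 0 < size p, uniq (unzip1 p), uniq (unzip2 p)
    & cycle (fun x y => ends x.2 == [set x.1; y.1]) p].

(* A cycle has no isolated vertex, so it is determined by its edge set and is
   identified with it; its length is then [#|C|]. *)
Definition is_cycle C :=
  [exists p : #|C|.-tuple (vertex G * edge G),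
     cyclic_walk p && (C == [set e in unzip2 p])].

Lemma is_cycleP C :
  reflect (exists2 p, cyclic_walk p & C = [set e in unzip2 p]) (is_cycle C).
Proof.
apply: (iffP existsP) => [[p /andP[pP /eqP CE]]|[p pP CE]].
  by exists (tval p).
have sz_p : size p == #|C|.
  case/and4P: pP => _ _ uniq_e _.
  by rewrite CE cardsE (card_uniqP uniq_e) size_map.
by exists (Tuple sz_p); rewrite /= pP -CE eqxx.
Qed.

Definition hits Y C := Y :&: C != set0.

Definition F_cycle F C := is_cycle C && (F :&: C != set0).

Definition hits_all_F_cycles F Y := [forall C, F_cycle F C ==> hits Y C].

Definition edge_disjoint_cycles CC :=
  [forall C in CC, is_cycle C] && trivIset CC.

(* The two families over which the maximum and the minimum are taken are
   nonempty, so neither of them takes a default value. *)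
Lemma edge_disjoint_cycles0 : edge_disjoint_cycles set0.
Proof.
apply/andP; split; first by apply/forall_inP => C; rewrite inE.
by apply/trivIsetP => C D; rewrite inE.
Qed.

Lemma hits_all_F_cyclesT F : hits_all_F_cycles F [set: edge G].
Proof.
apply/forallP => C; apply/implyP => /andP[_]; rewrite /hits setTI.
by apply: contraNneq => ->; rewrite setI0.
Qed.

End Cycles.

(* Main.v *)
Require Import Defs.
From mathcomp Require Import all_boot.

(** Let [Y] be an inclusion-minimal subset of [F] hitting all [F]-cycles. By
    minimality each [y] in [Y] lies on a cycle [C y] meeting [Y] only in [y], so
    the symmetric difference of all the [C y] contains [Y]. It belongs to the
    cycle space, hence it is a union of edge-disjoint cycles, and these cover at
    least [#|Y|] edges of [F]. *)

Set Implicit Arguments.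
Unset Strict Implicit.
Unset Printing Implicit Defensive.

Section CycleSpace.

Variable G : graph.
Implicit Types (S : {set vertex G}) (e f : edge G) (A C F H Y : {set edge G}).

Definition crossing S e := (ends e :&: S != set0) && ~~ (ends e \subset S).

Lemma crossingE S e x y :
  ends e = [set x; y] -> crossing S e = (x \in S) (+) (y \in S).
Proof.
move=> Ee; rewrite /crossing Ee setIUl setU_eq0 !setI_eq0 !disjoints1.
by rewrite subUset !sub1set; do 2!case: (_ \in S).
Qed.

(* The cycle space is taken to be the orthogonal complement of the cut space. *)
Definition in_cycle_space H :=
  forall S, \big[addb/false]_(e in H) crossing S e = false.

(** Telescoping modulo 2: each inner vertex contributes twice and cancels. [belast] drops the last
    pair, whose edge leads out of the final vertex. *)
Lemma crossing_path S x s :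
    path (fun x y : vertex G * edge G => ends x.2 == [set x.1; y.1]) x s ->
  \big[addb/false]_(z <- belast x s) crossing S z.2 =
    (x.1 \in S) (+) ((last x s).1 \in S).
Proof.
elim: s x => [|y s IHs] x /=; first by rewrite big_nil addbb.
case/andP=> /eqP Ex /IHs{}IHs.
by rewrite big_cons IHs (crossingE _ Ex) -addbA addKb.
Qed.

Lemma is_cycle_in_cycle_space C : is_cycle C -> in_cycle_space C.
Proof.
case/is_cycleP=> p /and4P[p_gt0 _ uniq_e cyc_p] -> S.
under eq_bigl do rewrite inE.
rewrite -big_uniq // big_map.
case: p p_gt0 cyc_p {uniq_e} => // x s _ /(crossing_path S).
by rewrite belast_rcons last_rcons addbb.
Qed.

Lemma is_cycle_neq0 C : is_cycle C -> C != set0.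
Proof.
case/is_cycleP=> -[|[x e] p] // _ ->.
by apply/set0Pn; exists e; rewrite !inE eqxx.
Qed.

Lemma in_cycle_spaceD H C :
  C \subset H -> in_cycle_space H -> in_cycle_space C -> in_cycle_space (H :\: C).
Proof.
move=> /setIidPr CH Hev Cev S; have := Hev S.
by rewrite (big_setID C) /= CH Cev.
Qed.

(** This set is the symmetric difference of the [K i]. Conjunction is the product modulo 2, so it
    distributes over the sum, and the two sums can be exchanged. *)
Lemma in_cycle_space_sum (I : finType) (B : {set I}) (K : I -> {set edge G}) :
    (forall i, i \in B -> in_cycle_space (K i)) ->
  in_cycle_space [set e | \big[addb/false]_(i in B) (e \in K i)].
Proof.
move=> Kev S; rewrite big_mkcond /=.
under eq_bigr => e _.
  rewrite inE -[if _ then _ else _]/(_ && _) big_distrl /=.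
  over.
rewrite exchange_big /= big1 // => i iB.
by rewrite -big_mkcond; apply: Kev.
Qed.

(** Chooses an edge of [A] for each step of a simple vertex path. The bound on the ends makes these
    edges distinct: the edge leaving [x] contains [x], later ones do not. The free [w], [e] and [z]
    allow the walk to be closed up. *)
Lemma path_edges A x p :
    path (fun x y => [exists e in A, ends e == [set x; y]]) x p ->
    uniq (x :: p) ->
  exists q : seq (vertex G * edge G),
    [/\ unzip1 q = belast x p, uniq (unzip2 q),
        {in unzip2 q, forall e, e \in A /\ {subset ends e <= x :: p}} &
        forall w e z, ends e = [set w; x] -> z.1 = last x p ->
          path (fun x y => ends x.2 == [set x.1; y.1]) (w, e) (rcons q z)].
Proof.
elim: p x => [|y p IHp] x /=.
  by exists [::]; split=> // w e z Ee /= ->; rewrite Ee eqxx.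
case/andP=> /exists_inP[f fA /eqP Ef] /IHp{}IHp /andP[x_notin /IHp].
case=> q [q1 q2 qA qP]; exists ((x, f) :: q); split=> /=.
- by rewrite q1.
- rewrite q2 andbT; apply/negP=> /qA[_ /(_ x)].
  by rewrite Ef set21 (negPf x_notin) => /(_ isT).
- move=> e; rewrite inE => /predU1P[->|/qA[eA eS]]; split=> // z.
    by rewrite Ef !inE => /orP[]/eqP->; rewrite eqxx ?orbT.
  by move/eS=> zp; rewrite inE zp orbT.
- by move=> w e z Ee zE; rewrite Ee eqxx qP.
Qed.

Lemma ends_pair e : exists x y, ends e = [set x; y].
Proof.
have := ends_card e; rewrite [_ <= 2]leq_eqVlt ltnS andb_orr.
case/orP=> [/andP[_ /cards2P[x [y [_ ->]]]]|]; first by exists x, y.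
by rewrite andbC -eqn_leq => /cards1P[x ->]; exists x, x; rewrite setUid.
Qed.

(* The cut around the component of one end of [e] in [H :\ e] is crossed by no
   edge of [H] but possibly [e], hence by none: the other end of [e] lies in that
   component, and a path joining the two closes up to a cycle. *)
Lemma cycle_space_cycle H e :
    in_cycle_space H -> e \in H ->
  exists C, [/\ is_cycle C, e \in C & C \subset H].
Proof.
move=> Hev eH; have [v [u Ee]] := ends_pair e.
pose r x y := [exists f in H :\ e, ends f == [set x; y]].
have r_sym x y : r x y = r y x by rewrite /r setUC.
have uv : connect r u v.
  have := Hev [set x | connect r u x].
  rewrite (big_setD1 e) //= big1 => [|f fHe].
    by rewrite addbF (crossingE _ Ee) !inE connect0; case: connect.
  have [x [y Ef]] := ends_pair f.
  have rxy : r x y by apply/exists_inP; exists f; rewrite ?Ef.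
  rewrite (crossingE _ Ef) !inE.
  suff ->: connect r u x = connect r u y by rewrite addbb.
  apply/idP/idP => /connect_trans; apply; apply: connect1 => //.
  by rewrite r_sym.
have [p0 /shortenP[p rp up _] vE] := connectP uv.
(* The entry [(v, e)] serves both as the start and as the closing pair of the walk. If [e] is a
   loop, then [q] is empty. *)
have [q [q1 q2 qA /(_ v e (v, e) Ee vE) qP]] := path_edges rp up.
exists [set f in unzip2 ((v, e) :: q)]; split.
- apply/is_cycleP; exists ((v, e) :: q) => //; apply/and4P; split=> //=.
  + by rewrite q1 vE -rcons_uniq -lastI.
  + by rewrite q2 andbT; apply/negP=> /qA[]; rewrite !inE eqxx.
- by rewrite inE mem_head.
- apply/subsetP=> f; rewrite !inE => /predU1P[->//|/qA[]].
  by rewrite !inE => /andP[].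
Qed.

(** Induction on [#|H|]: removing a cycle from [H] leaves a smaller element of the cycle space. *)
Lemma cycle_space_decomposition H :
    in_cycle_space H ->
  exists2 CC : {set {set edge G}}, edge_disjoint_cycles CC & cover CC = H.
Proof.
have [n] := ubnP #|H|; elim: n H => // n IHn H Hn Hev.
have [->|/set0Pn[e eH]] := eqVneq H set0.
  by exists set0; [apply: edge_disjoint_cycles0 | apply: big_set0].
have [C [Ccyc eC CH]] := cycle_space_cycle Hev eH.
have ltHC : #|H :\: C| < n.
  rewrite -ltnS; apply: leq_trans Hn; rewrite ltnS; apply/proper_card.
  by apply/properP; split; [apply: subsetDl | exists e; rewrite // !inE eC].
have HCev := in_cycle_spaceD CH Hev (is_cycle_in_cycle_space Ccyc).
have [CC /andP[/forall_inP CCcyc CCtriv] CCE] := IHn _ ltHC HCev.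
have disjC B : B \in CC -> [disjoint C & B].
  move=> BCC; rewrite disjoint_sym; apply: disjointWl (_ : [disjoint H :\: C & C]).
    by rewrite -CCE; apply: (bigcup_max B).
  by rewrite -setI_eq0 setIDAC setDIl setDv setI0.
(* Since [C] is disjoint from every member of [CC], it could belong to [CC] only if it were
   empty. *)
have CC0 : set0 \notin CC by apply/negP=> /CCcyc/is_cycle_neq0; rewrite eqxx.
have [CtrivU CnCC] := trivIsetU1 disjC CCtriv CC0.
exists (C |: CC).
  apply/andP; split=> //; apply/forall_inP=> B.
  by rewrite !inE => /predU1P[->|/CCcyc].
by rewrite /cover big_setU1 //= -/(cover CC) CCE -{1}(setIidPr CH) setID.
Qed.

(** Some [F]-cycle is missed by [Y :\ y], yet [Y] hits it, so it does so in [y] alone. *)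
Lemma minimal_hitting_cycle F Y y :
    minset (fun Z => (Z \subset F) && hits_all_F_cycles F Z) Y ->
    y \in Y ->
  exists2 C, is_cycle C & Y :&: C = [set y].
Proof.
case/minsetP=> /andP[YF Yhit] Ymin yY.
have: ~~ hits_all_F_cycles F (Y :\ y).
  apply/negP=> Yyhit.
  have YyE := Ymin _ (introT andP (conj (subset_trans (subD1set _ _) YF) Yyhit))
                (subD1set _ _).
  by move: yY; rewrite -YyE !inE eqxx.
case/forallPn=> C; rewrite negb_imply negbK => /andP[FC /eqP YC0].
exists C; first by case/andP: FC.
have /set0Pn[z] := implyP (forallP Yhit C) FC.
rewrite inE => /andP[zY zC].
have onlyy x : x \in Y -> x \in C -> x = y.
  move=> xY xC; apply/eqP; apply: contraTT isT => xy.
  by have := in_set0 x; rewrite -YC0 !inE xy xY xC.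
apply/setP=> x; rewrite !inE; apply/andP/eqP => [[]|->]; first exact: onlyy.
by rewrite yY -(onlyy z zY zC).
Qed.

End CycleSpace.

Theorem theorem2p1 (G : graph) (F : {set edge G}) :
  \max_(CC : {set {set edge G}} | edge_disjoint_cycles CC) #|F :&: cover CC|
  >= #|[arg min_(Y < [set: edge G] | hits_all_F_cycles F Y) #|Y| ]|.
Proof.
have Fhit : (F \subset F) && hits_all_F_cycles F F.
  by rewrite subxx; apply/forallP=> C; apply/implyP=> /andP[].
have [Y Ymin _] :=
  minset_exists (P := fun Z => (Z \subset F) && hits_all_F_cycles F Z) Fhit.
have /andP[YF Yhit] := minsetp Ymin.
(* The default [set0] is never taken for [y] in [Y], by [KP]. *)
pose K y := odflt set0 [pick C | is_cycle C && (Y :&: C == [set y])].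
have KP y : y \in Y -> is_cycle (K y) /\ Y :&: K y = [set y].
  move=> yY; rewrite /K; case: pickP => [C /andP[Ccyc /eqP]//|noC].
  have [C Ccyc YC] := minimal_hitting_cycle Ymin yY.
  by have := noC C; rewrite Ccyc YC eqxx.
have Hev := in_cycle_space_sum
  (fun y yY => is_cycle_in_cycle_space (proj1 (KP y yY))).
have [CC CCdisj CCE] := cycle_space_decomposition Hev.
apply: leq_trans (leq_bigmax_cond _ CCdisj).
apply: (@leq_trans #|Y|); last first.
  apply/subset_leq_card/subsetP=> y yY.
  rewrite inE (subsetP YF) // CCE inE.
  (* Only the term [x = y] contributes to the sum modulo 2 at [y], so [y] survives in the symmetric
     difference. *)
  have inK x : x \in Y -> (y \in K x) = (y == x).
    by move=> /KP[_ /setP/(_ y)]; rewrite !inE yY.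
  rewrite (bigD1 y) //= inK // eqxx big1 // => x /andP[xY xy].
  by rewrite inK // eq_sym (negPf xy).
by case: arg_minnP => [|Z _ /(_ Y Yhit)//]; apply: hits_all_F_cyclesT.
Qed.
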